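(* Let $R$ be a unique factorization domain and let $K$ be its field of fractions. Then $R$ is a D-ring if and only if the following holds: for all $f(x),g(x)\in R[x]$ with $g(x)$ nonconstant and primitive such that for all $k\in R$ ($g(k)\neq 0$ implies $g(k)\mid f(k)$ in $R$), one has $g(x)\mid f(x)$ in $R[x]$.
   Context: All rings are commutative with identity. An integral domain $R$ with field of fractions $K$ is called a D-ring if, for all polynomials $f(x),g(x)\in R[x]$ with $g(x)\neq 0$ such that $g(k)\mid f(k)$ in $R$ for almost all $k\in R$ (i.e. for all but finitely many $k\in R$), one has $\frac{f(x)}{g(x)}\in K[x]$, i.e. $g(x)$ divides $f(x)$ in $K[x]$. For a unique factorization domain $R$, a polynomial in $R[x]$ is primitive if its content (the greatest common divisor of its coefficients) is a unit. *)

(* Defs.v *)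
From mathcomp Require Import all_boot all_algebra.

Set Implicit Arguments.
Unset Strict Implicit.
Unset Printing Implicit Defensive.

Import GRing.Theory.
Local Open Scope ring_scope.

(* Divisibility in the ring itself. Over {poly R} with R only an integral
   domain, polydiv's %| is pseudo-divisibility, that is divisibility in K[x],
   so divisibility in R[x] has to be stated with this predicate. *)
Definition divides (R : comNzRingType) (a b : R) : Prop :=
  exists c : R, b = c * a.

Definition associated (R : idomainType) (a b : R) : Prop :=
  exists2 u : R, u \is a GRing.unit & b = u * a.

Definition irreducible_elt (R : idomainType) (p : R) : Prop :=
  [/\ p != 0, p \isn't a GRing.unit &
      forall a b : R, p = a * b ->
        a \is a GRing.unit \/ b \is a GRing.unit].

Definition irreducible_factorization (R : idomainType) (a : R) (s : seq R)
  : Prop :=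
  (forall p, p \in s -> irreducible_elt p) /\ a = \prod_(p <- s) p.

Definition is_UFD (R : idomainType) : Prop :=
  forall a : R, a != 0 -> a \isn't a GRing.unit ->
    (exists s, irreducible_factorization a s) /\
    (forall s t, irreducible_factorization a s ->
       irreducible_factorization a t ->
       exists t', [/\ perm_eq t t', size s = size t' &
                      forall i, (i < size s)%N -> associated s`_i t'`_i]).

Definition is_gcd (R : idomainType) (d : R) (s : seq R) : Prop :=
  (forall a, a \in s -> divides d a) /\
  (forall e, (forall a, a \in s -> divides e a) -> divides e d).

Definition primitive_poly (R : idomainType) (p : {poly R}) : Prop :=
  exists2 c : R, is_gcd c p & c \is a GRing.unit.

Definition almost_all (T : eqType) (P : T -> Prop) : Prop :=
  exists e : seq T, forall k, k \notin e -> P k.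

Definition frac_poly (R : idomainType) (p : {poly R}) : {poly {fraction R}} :=
  map_poly (@tofrac R) p.

Definition is_D_ring (R : idomainType) : Prop :=
  forall f g : {poly R}, g != 0 ->
    almost_all (fun k => divides g.[k] f.[k]) ->
    frac_poly g %| frac_poly f.

(* Main.v *)
Require Import Defs.
From mathcomp Require Import all_boot all_algebra.

Set Implicit Arguments.
Unset Strict Implicit.
Unset Printing Implicit Defensive.

Import GRing.Theory.
Local Open Scope ring_scope.

(** If [g] divides [f] at almost all points, then [g] divides [C f] wherever
    [g] does not vanish, where [C] is the product of the nonzero values of [g]
    at the finitely many exceptional points; scalars are invisible in [K[x]],
    so there [g] may moreover be replaced by its primitive part.  Conversely a
    nonzero [g] has finitely many roots, and by Gauss's lemma a primitive [g]
    dividing [f] in [K[x]] divides it in [R[x]]. *)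

Lemma dividesMr (R : comNzRingType) (a b c : R) :
  divides a b -> divides a (b * c).
Proof. by case=> d ->; exists (d * c); rewrite mulrAC. Qed.

Lemma dividesMl (R : comNzRingType) (a b c : R) :
  divides a b -> divides a (c * b).
Proof. by rewrite mulrC; apply: dividesMr. Qed.

Lemma divides_trans (R : comNzRingType) (a b c : R) :
  divides a b -> divides b c -> divides a c.
Proof. by move=> + [d ->]; apply: dividesMl. Qed.

Lemma dividesD (R : comNzRingType) (a b c : R) :
  divides a b -> divides a c -> divides a (b + c).
Proof. by move=> [d ->] [e ->]; exists (d + e); rewrite mulrDl. Qed.

Lemma divides_prod (R : comNzRingType) (I : eqType) (F : I -> R) (P : pred I)
    (s : seq I) (i : I) :
  i \in s -> P i -> divides (F i) (\prod_(j <- s | P j) F j).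
Proof.
move=> + Pi; elim: s => // j s IHs; rewrite inE big_cons.
case/predU1P=> [<- | /IHs Fi]; last by case: ifP => // _; apply: dividesMl.
by rewrite Pi; apply: dividesMr; exists 1; rewrite mul1r.
Qed.

Lemma divides_unit (R : idomainType) (a u : R) :
  u \is a GRing.unit -> divides a u -> a \is a GRing.unit.
Proof. by move=> + [c e]; rewrite e unitrM => /andP[]. Qed.

Lemma divides_polyCP (R : comNzRingType) (a : R) (p : {poly R}) :
  divides a%:P p <-> (forall i, divides a p`_i).
Proof.
split=> [[q ->] i | ]; first by exists q`_i; rewrite coefMC.
elim/poly_ind: p => [|p c IHp] ap; first by exists 0; rewrite mul0r.
apply: dividesD.
  apply: dividesMr; apply: IHp => i.
  by have := ap i.+1; rewrite coefD coefMX coefC addr0.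
have := ap 0%N; rewrite coefD coefMX coefC add0r => -[d ->].
by exists d%:P; rewrite polyCM.
Qed.

Lemma irreducible_divides_sym (R : idomainType) (p q : R) :
  irreducible_elt p -> irreducible_elt q -> divides q p -> divides p q.
Proof.
move=> [_ _ irr_p] [_ /negP q_nunit _] [c pE].
case: (irr_p _ _ pE) => // c_unit.
by exists c^-1; rewrite pE mulKr.
Qed.

Section UFD.

Variables (R : idomainType) (hR : is_UFD R).

(** Induction along a factorization; it lets later proofs strip irreducible factors from a scalar
    one at a time. *)
Lemma UFD_ind (P : R -> Prop) :
    (forall u, u \is a GRing.unit -> P u) ->
    (forall p a, irreducible_elt p -> P a -> P (p * a)) ->
  forall a, a != 0 -> P a.
Proof.
move=> Punit Pirr a a0; have [/Punit // | a_nunit] := boolP (a \is a GRing.unit).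
have [[s [irr_s ->]] _] := hR a0 a_nunit.
elim: s irr_s => [|p s IHs] irr_s; first by rewrite big_nil; apply/Punit/unitr1.
rewrite big_cons; apply: Pirr; first by apply: irr_s; rewrite mem_head.
by apply: IHs => q qs; apply: irr_s; rewrite inE qs orbT.
Qed.

Lemma UFD_irreducible_divisor (a : R) :
    a != 0 -> a \isn't a GRing.unit ->
  exists2 p, irreducible_elt p & divides p a.
Proof.
elim/UFD_ind => [u -> // | p b irr_p _ _].
by exists p => //; exists b; rewrite mulrC.
Qed.

(** If [a * b = c * p], then [p] followed by a factorization of [c], and the joined factorizations
    of [a] and [b], both factor [a * b]. By uniqueness [p] is associated to an entry of the latter.
    Zeros and units are treated first, since [is_UFD] covers only nonzero nonunits. *)
Lemma UFD_irreducible_prime (p a b : R) :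
  irreducible_elt p -> divides p (a * b) -> divides p a \/ divides p b.
Proof.
move=> irr_p [c abE]; have [p0 p_nunit irr] := irr_p.
have [-> | a0] := eqVneq a 0; first by left; exists 0; rewrite mul0r.
have [-> | b0] := eqVneq b 0; first by right; exists 0; rewrite mul0r.
have [a_unit | a_nunit] := boolP (a \is a GRing.unit).
  by right; exists (a^-1 * c); rewrite -mulrA -abE mulKr.
have [b_unit | b_nunit] := boolP (b \is a GRing.unit).
  by left; exists (b^-1 * c); rewrite -mulrA -abE mulrCA mulVr // mulr1.
have [c_unit | c_nunit] := boolP (c \is a GRing.unit).
  have pE : p = (c^-1 * a) * b by rewrite -mulrA abE mulKr.
  case: (irr _ _ pE) => [|bu]; last by rewrite bu in b_nunit.
  by rewrite unitrM (negPf a_nunit) andbF.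
have ab0 : a * b != 0 by rewrite mulf_neq0.
have c0 : c != 0 by apply: contraNneq ab0 => c0; rewrite abE c0 mul0r.
have [[sa [irr_sa aE]] _] := hR a0 a_nunit.
have [[sb [irr_sb bE]] _] := hR b0 b_nunit.
have [[sc [irr_sc cE]] _] := hR c0 c_nunit.
have [|_ /(_ (p :: sc) (sa ++ sb)) uniq_ab] := hR ab0.
  by rewrite unitrM (negPf a_nunit).
have [||t [perm_t size_t assoc_t]] := uniq_ab.
- split=> [q|]; first by rewrite inE => /predU1P[-> // | /irr_sc].
  by rewrite big_cons -cE abE mulrC.
- split=> [q|]; first by rewrite mem_cat => /orP[/irr_sa | /irr_sb].
  by rewrite big_cat -aE -bE.
have [u u_unit tE] := assoc_t 0%N isT.
have : t`_0 \in sa ++ sb by rewrite (perm_mem perm_t) mem_nth -?size_t.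
have p_t : divides p t`_0 by exists u.
rewrite mem_cat => /orP[] t_in; [left; rewrite aE | right; rewrite bE].
  exact: divides_trans p_t (divides_prod id t_in isT).
exact: divides_trans p_t (divides_prod id t_in isT).
Qed.

(* If [p] divides [f * g], it divides the product of the leading coefficients,
   hence one of the two leading terms, which can then be removed. *)
Lemma UFD_irreducible_polyC_prime (p : R) (f g : {poly R}) :
    irreducible_elt p -> divides p%:P (f * g) ->
  divides p%:P f \/ divides p%:P g.
Proof.
move=> irr_p; have [n] := ubnP (size f + size g).
elim: n f g => // n IHn f g; rewrite ltnS => le_n p_fg.
wlog p_f : f g le_n p_fg / divides p (lead_coef f).
  move=> wlog_f; have p_lc : divides p (lead_coef f * lead_coef g).
    by rewrite -lead_coefM lead_coefE; move/divides_polyCP: p_fg.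
  have [|p_g] := UFD_irreducible_prime irr_p p_lc; first exact: wlog_f.
  by apply/or_comm; apply: wlog_f p_g; rewrite 1?addnC // mulrC.
have [-> | f0] := eqVneq f 0; first by left; exists 0; rewrite mul0r.
set m := lead_coef f *: 'X^((size f).-1).
have p_m : divides p%:P m.
  by apply/divides_polyCP=> i; rewrite coefZ; apply: dividesMr.
have p_Nm : divides p%:P (- m) by rewrite -mulN1r; apply: dividesMl.
have size_fm : (size (f - m)%R < size f)%N.
  have size_f : size f = (size f).-1.+1 by rewrite prednK ?size_poly_gt0.
  rewrite [X in (_ < X)%N]size_f ltnS.
  apply/leq_sizeP=> i; rewrite coefB coefZ coefXn leq_eqVlt.
  case/predU1P=> [<- | lt_i]; first by rewrite eqxx mulr1 lead_coefE subrr.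
  by rewrite gtn_eqF // mulr0 subr0 nth_default // size_f.
have [|||] := IHn (f - m) g; last by right.
- by apply: leq_trans le_n; rewrite ltn_add2r.
- by rewrite mulrDl; apply: dividesD p_fg _; apply: dividesMr.
by move=> p_fm; left; rewrite -(subrK m f); apply: dividesD.
Qed.

(** The irreducible factors of [c] are cancelled one by one: each divides the cofactor or [g], and
    the latter would make it divide the unit content of [g]. *)
Lemma primitive_dividesZ (c : R) (f g : {poly R}) :
  primitive_poly g -> c != 0 -> divides g (c *: f) -> divides g f.
Proof.
case=> d [_ gcd_d] d_unit; move=> c0; move: c c0 f.
apply: UFD_ind => [u u_unit | p c irr_p IHc] f [q].
  by move=> fE; exists (u^-1 *: q); rewrite -scalerAl -fE scalerA mulVr ?scale1r.
have [p0 /negP p_nunit _] := irr_p.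
rewrite -scalerA => fE; apply: IHc.
have p_qg : divides p%:P (q * g) by exists (c *: f); rewrite -fE -mul_polyC mulrC.
case: (UFD_irreducible_polyC_prime irr_p p_qg) => [[r qE] | /divides_polyCP p_g].
  exists r; have pP0 : p%:P != 0 by rewrite polyC_eq0.
  by apply: (mulfI pP0); rewrite mul_polyC fE qE mulrCA mulrA.
case: p_nunit; apply: divides_unit d_unit (gcd_d _ _) => a /(nthP 0)[i _ <-].
exact: p_g.
Qed.

(* Irreducible divisors of the leading coefficient are extracted one at a time
   from [g]; [b] collects those that have been found not to divide [g]. *)
Lemma UFD_primitive_part (g : {poly R}) : g != 0 ->
  classically (exists c (h : {poly R}), [/\ c != 0, primitive_poly h & g = c *: h]).
Proof.
(* Here [a] is the part of the leading coefficient still to be examined; at the start it is all of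
   it, and [b = 1]. *)
move=> g0; suff main a : a != 0 -> forall (b : R) (h : {poly R}),
    h != 0 -> lead_coef h = b * a ->
    (forall q, irreducible_elt q -> divides q b -> ~ divides q%:P h) ->
    classically (exists c (k : {poly R}),
                   [/\ c != 0, primitive_poly k & h = c *: k]).
  apply: (main (lead_coef g) _ 1) => //; rewrite ?lead_coef_eq0 ?mul1r //.
  by move=> q [_ /negP q_nunit _] /(divides_unit (unitr1 R)).
elim/UFD_ind => {a} [u u_unit | p a irr_p IHa] b h h0 hE b_h.
  (* Nothing is left to examine, so [b] is the leading coefficient up to a unit. An irreducible
     factor of a common divisor of the coefficients would divide [b], against [b_h]; so [h] is
     primitive. *)
  move=> B; apply; exists 1, h; split; rewrite ?oner_eq0 ?scale1r //.
  exists 1; last exact: unitr1.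
  split=> [x _ | e e_h]; first by exists x; rewrite mulr1.
  have e_lead : divides e (lead_coef h) by apply/e_h/mem_nth; rewrite prednK ?size_poly_gt0.
  have [e_unit | e_nunit] := boolP (e \is a GRing.unit).
    by exists e^-1; rewrite mulVr.
  have e0 : e != 0.
    apply: contraTneq h0 => e0; rewrite negbK -lead_coef_eq0.
    by case: e_lead => d ->; rewrite e0 mulr0.
  have [q irr_q q_e] := UFD_irreducible_divisor e0 e_nunit.
  have [] := b_h q irr_q.
    have -> : b = lead_coef h * u^-1 by rewrite hE mulrK.
    exact: dividesMr (divides_trans q_e e_lead).
  apply/divides_polyCP=> i; apply: divides_trans q_e _.
  have [lt_i | ge_i] := ltnP i (size h); first exact/e_h/mem_nth.
  by exists 0; rewrite nth_default // mul0r.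
have [p0 _ _] := irr_p; have pP0 : p%:P != 0 by rewrite polyC_eq0.
(* Divisibility in [R] is not decidable, hence the classical case split: [p] is either divided out
   of [h] or moved to [b]. *)
move=> B goal; apply: (@classic_EM (divides p%:P h)) => [[[k kE] | p_h]].
- apply: (IHa b k) => [||q irr_q q_b q_k|[c [l [c0 prim_l lE]]]].
  + by apply: contraNneq h0 => k0; rewrite kE k0 mul0r.
  + by apply: (mulIf p0); rewrite -[p in LHS]lead_coefC -lead_coefM -kE hE mulrCA mulrC.
  + by apply: (b_h q irr_q q_b); rewrite kE; apply: dividesMr.
  apply: goal; exists (p * c), l; split=> //; first exact: mulf_neq0.
  by rewrite kE lE mulrC mul_polyC scalerA.
apply: (IHa (b * p) h) => // [|q irr_q q_bp q_h]; first by rewrite -mulrA.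
case: (UFD_irreducible_prime irr_q q_bp) => [q_b | q_p]; first exact: b_h q_h.
have [c qE] := irreducible_divides_sym irr_p irr_q q_p.
by apply: p_h; apply: divides_trans q_h; exists c%:P; rewrite -polyCM -qE.
Qed.

End UFD.

Lemma tofrac_inj (R : idomainType) : injective (@tofrac R).
Proof. by move=> a b /eqP; rewrite tofrac_eq => /eqP. Qed.

(** Pseudo-division clears the denominators: [c] is the power of the leading coefficient of [g] that
    it introduces. The remainder vanishes because over the fraction field it is a multiple of [g] of
    smaller size. *)
Lemma frac_poly_dvdp (R : idomainType) (f g : {poly R}) : g != 0 ->
    frac_poly g %| frac_poly f ->
  exists2 c : R, c != 0 & divides g (c *: f).
Proof.
move=> g0 g_f; exists (lead_coef g ^+ scalp f g).
  by rewrite expf_neq0 // lead_coef_eq0.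
exists (f %/ g); rewrite Pdiv.Idomain.divp_eq.
suff -> : f %% g = 0 by rewrite addr0.
have size_frac := size_map_inj_poly (@tofrac_inj R) (rmorph0 _).
have : frac_poly g %| frac_poly (f %% g).
  have -> : f %% g = lead_coef g ^+ scalp f g *: f - f %/ g * g.
    by rewrite Pdiv.Idomain.divp_eq addrC addKr.
  rewrite /frac_poly rmorphB rmorphM /= map_polyZ.
  by rewrite -mul_polyC dvdp_sub // dvdp_mull.
move=> g_r; apply/eqP; apply: contraTT g_r => r0.
rewrite gtNdvdp ?size_frac ?Pdiv.Idomain.ltn_modp //.
by rewrite -size_poly_gt0 size_frac size_poly_gt0.
Qed.

(** Linear factors are split off by induction on the size. The result is only [classically] true
    because the existence of a root in [R] is not decidable. *)
Lemma finite_roots (R : idomainType) (g : {poly R}) :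
  g != 0 -> classically (exists e : seq R, forall k, root g k -> k \in e).
Proof.
have [n] := ubnP (size g); elim: n g => // n IHn g.
rewrite ltnS => le_g g0 B goal.
apply: (@classic_EM (exists k, root g k)) => [[[k]|no_root]]; last first.
  by apply: goal; exists [::] => k gk; case: no_root; exists k.
case/factor_theorem=> q gE; have q0 : q != 0.
  by apply: contraNneq g0 => q0; rewrite gE q0 mul0r.
apply: (IHn q) => // [|[e q_e]].
  by apply: leq_trans le_g; rewrite gE size_Mmonic ?monicXsubC // size_XsubC addn2.
apply: goal; exists (k :: e) => x.
by rewrite gE rootM root_XsubC inE orbC => /orP[-> | /q_e ->]; rewrite ?orbT.
Qed.

Theorem proposition2p5 (R : idomainType) (hR : is_UFD R) :
  is_D_ring R <->
  (forall f g : {poly R}, (1 < size g)%N -> primitive_poly g ->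
     (forall k : R, g.[k] != 0 -> divides g.[k] f.[k]) ->
     divides g f).
Proof.
split=> [D_R f g size_g prim_g g_f | H f g g0 [e g_f]].
  have g0 : g != 0 by rewrite -size_poly_gt0 ltnW.
  suff g_frac : frac_poly g %| frac_poly f.
    have [c c0 g_cf] := frac_poly_dvdp g0 g_frac.
    exact (primitive_dividesZ hR prim_g c0 g_cf).
  (* The goal [%|] over the fraction field is boolean, so [classically] can be eliminated here, and
     likewise for the primitive part below. *)
  apply: (finite_roots g0) => [[e g_e]]; apply: D_R => //.
  by exists e => k k_e; apply: g_f; apply: contra k_e => /g_e.
apply: (UFD_primitive_part hR g0) => [[c [h [c0 prim_h gE]]]].
have cF0 : tofrac c != 0 by rewrite tofrac_eq0.
rewrite gE /frac_poly map_polyZ dvdpZl //.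
(* [H] needs a nonconstant polynomial; a constant [h] becomes a nonzero scalar over the fraction
   field and divides everything. *)
have [size_h | size_h] := leqP (size h) 1.
  have h0 : h`_0 != 0.
    by apply: contraNneq g0 => h0; rewrite gE (size1_polyC size_h) h0 scaler0.
  by rewrite (size1_polyC size_h) map_polyC -alg_polyC dvdpZl ?tofrac_eq0 ?dvd1p.
pose C := \prod_(k <- e | h.[k] != 0) h.[k].
have C0 : C != 0 by rewrite prodf_seq_neq0; apply/allP => k _; apply/implyP.
have [|q CfE] := H (C *: f) h size_h prim_h.
  move=> k hk; rewrite hornerZ.
  (* At an exceptional [k], the nonzero value [h.[k]] is a factor of [C]; elsewhere it divides
     [g.[k]], which divides [f.[k]]. *)
  have [k_e | /g_f] := boolP (k \in e); first exact/dividesMr/divides_prod.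
  rewrite gE hornerZ => h_f; apply: dividesMl; apply: divides_trans h_f.
  by exists c.
rewrite -(dvdpZr _ _ (_ : tofrac C != 0)) ?tofrac_eq0 //.
by rewrite -map_polyZ CfE rmorphM dvdp_mull.
Qed.
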